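(* Let $n,k\ge1$ be integers with $k\le n/4$, let $\mathbf z=(1/\sqrt k,\dots,1/\sqrt k,0,\dots,0)^\top\in\mathbb R^n$ be supported on the first $k$ entries and $\mathbf z_\perp=(0,\dots,0,1/\sqrt{n-k},\dots,1/\sqrt{n-k})^\top\in\mathbb R^n$ be supported on the last $n-k$ entries, and consider the problem $$\min_{\mathbf X\in\mathcal S_n}\Big\{g(\mathbf X):=-\langle\mathbf z\mathbf z^\top+\mathbf z_\perp\mathbf z_\perp^\top,\mathbf X\rangle+\frac1{2k}\|\mathbf X\|_1\Big\}.$$ Then $\mathbf z\mathbf z^\top$ is a rank-one optimal solution for which strict complementarity holds (with some parameter $\delta>0$). However, for any $0<\eta<\frac23$ and any $\mathbf v\in\mathbb R^n$ such that $\|\mathbf v\|=1$, $\mathrm{support}(\mathbf v)\subseteq\mathrm{support}(\mathbf z)$, and $\langle\mathbf z,\mathbf v\rangle^2=1-\frac12\|\mathbf v\mathbf v^\top-\mathbf z\mathbf z^\top\|_F^2\ge1-\frac1{2k^2}$, it holds that $$\mathrm{rank}\left(\Pi_{\mathcal S_n}[\mathbf v\mathbf v^\top-\eta\,\mathbf G_{\mathbf v\mathbf v^\top}]\right)>1,$$ where $\mathbf G_{\mathbf v\mathbf v^\top}=-\mathbf z\mathbf z^\top-\mathbf z_\perp\mathbf z_\perp^\top+\frac1{2k}\mathrm{sign}(\mathbf v\mathbf v^\top)\in\partial g(\mathbf v\mathbf v^\top)$.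
   Context: $\mathbb S^n$ is the space of real symmetric $n\times n$ matrices with trace inner product; $\lambda_i(\mathbf X)$ is the $i$-th largest eigenvalue; $\mathcal S_n=\{\mathbf X\in\mathbb S^n:\mathrm{Tr}(\mathbf X)=1,\mathbf X\succeq0\}$; $\Pi_{\mathcal S_n}$ is the Euclidean (Frobenius) projection onto $\mathcal S_n$; $\|\mathbf X\|_1=\sum_{i,j}|\mathbf X_{ij}|$ is the entrywise $\ell_1$ norm; $\mathrm{sign}(\cdot)$ is applied entrywise; $\partial g$ is the convex subdifferential; $\mathrm{support}$ is the set of indices of nonzero entries. Strict complementarity: for $\min_{\mathbf X\in\mathcal S_n}g(\mathbf X)$ with $g$ convex on $\mathbb S^n$, let $q(\mathbf Z,s)=\min_{\mathbf X\in\mathbb S^n}\{g(\mathbf X)+s(1-\mathrm{Tr}(\mathbf X))-\langle\mathbf Z,\mathbf X\rangle\}$; the dual problem is $\max\{q(\mathbf Z,s):\mathbf Z\succeq0,\ s\in\mathbb R,\ (\mathbf Z,s)\in\mathrm{dom}(q)\}$. An optimal solution $\mathbf X^*$ of rank $r^*$ satisfies strict complementarity with parameter $\delta>0$ if there exists an optimal dual solution $(\mathbf Z^*,s^* )\in\mathbb S^n\times\mathbb R$ with $\mathrm{rank}(\mathbf Z^* )=n-r^*$ and $\lambda_{n-r^*}(\mathbf Z^* )\ge\delta$. *)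

(* Defs.v *)
From HB Require Import structures.
From mathcomp Require Import all_boot all_order all_algebra.
From mathcomp Require Import all_classical all_reals ereal.

Set Implicit Arguments.
Unset Strict Implicit.
Unset Printing Implicit Defensive.

Import Order.TTheory GRing.Theory Num.Theory.
Local Open Scope classical_set_scope.
Local Open Scope ring_scope.

Section MatrixGeometry.
Variable R : realType.

(* Column vectors are the case n = 1, where this is the standard inner product
   of R^m; on symmetric matrices it is Tr (A B). *)
Definition inner (m n : nat) (A B : 'M[R]_(m, n)) : R := \tr (A^T *m B).

Definition l2norm (m n : nat) (A : 'M[R]_(m, n)) : R := Num.sqrt (inner A A).

Definition l1norm (m n : nat) (A : 'M[R]_(m, n)) : R :=
  \sum_(i < m) \sum_(j < n) `|A i j|.

Definition signmx (m n : nat) (A : 'M[R]_(m, n)) : 'M[R]_(m, n) :=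
  map_mx Num.sg A.

Definition outer (n : nat) (v : 'cV[R]_n) : 'M[R]_n := v *m v^T.

Definition vsupport (n : nat) (v : 'cV[R]_n) : pred 'I_n :=
  [pred i | v i 0 != 0].

Definition psd (n : nat) (A : 'M[R]_n) : Prop :=
  A \is symmetricmx /\ forall x : 'cV[R]_n, 0 <= inner x (A *m x).

Definition spectraplex (n : nat) : set 'M[R]_n :=
  [set X | psd X /\ \tr X = 1].

(* The eigenvalues listed with multiplicity in nonincreasing order; every
   symmetric real matrix has exactly one such list. *)
Definition spectrum_of (n : nat) (A : 'M[R]_n) : set (seq R) :=
  [set s | char_poly A = \prod_(a <- s) ('X - a%:P) /\ sorted >=%R s].

(* The i-th largest eigenvalue, counting from i = 1. *)
Definition eigval (n : nat) (i : nat) (A : 'M[R]_n) : R :=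
  nth 0 (xget [::] (spectrum_of A)) i.-1.

(* A point of S nearest to Y in Frobenius norm; it is unique when S is closed,
   convex and nonempty.  The default 0 is taken only if there is none. *)
Definition frob_proj (n : nat) (S : set 'M[R]_n) (Y : 'M[R]_n) : 'M[R]_n :=
  xget 0 [set P | S P /\ forall X, S X -> l2norm (Y - P) <= l2norm (Y - X)].

End MatrixGeometry.

Section ConvexProgram.
Variables (R : realType) (n : nat).
Implicit Types (g : 'M[R]_n -> R) (X Z G : 'M[R]_n) (s : R).

(* Functions on the space of symmetric matrices are given on all square
   matrices and only evaluated at symmetric ones. *)
Definition subdiff g X : set 'M[R]_n :=
  [set G | G \is symmetricmx /\
    forall Y, Y \is symmetricmx -> g X + inner G (Y - X) <= g Y].

Definition primal_optimal g X : Prop :=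
  spectraplex X /\ forall Y, spectraplex Y -> g X <= g Y.

Definition dual_value g Z s : \bar R :=
  ereal_inf [set (g X + s * (1 - \tr X) - inner Z X)%:E
            | X in [set X : 'M[R]_n | X \is symmetricmx]].

Definition dual_feasible g Z s : Prop :=
  psd Z /\ dual_value g Z s \is a fin_num.

Definition dual_optimal g Z s : Prop :=
  dual_feasible g Z s /\
  forall Z' s', dual_feasible g Z' s' ->
    (dual_value g Z' s' <= dual_value g Z s)%E.

Definition strict_complementarity g X (delta : R) : Prop :=
  [/\ primal_optimal g X, 0 < delta &
    exists Z s, [/\ dual_optimal g Z s,
                    \rank Z = (n - \rank X)%N &
                    delta <= eigval (n - \rank X) Z]].

End ConvexProgram.

Section Instance.
Variables (R : realType) (n k : nat).

Definition zvec : 'cV[R]_n :=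
  \col_(i < n) (if (i < k)%N then (Num.sqrt k%:R)^-1 else 0).

Definition zperp : 'cV[R]_n :=
  \col_(i < n) (if (k <= i)%N then (Num.sqrt (n - k)%:R)^-1 else 0).

Definition gobj (X : 'M[R]_n) : R :=
  - inner (outer zvec + outer zperp) X + (2 * k%:R)^-1 * l1norm X.

Definition gsubgrad (v : 'cV[R]_n) : 'M[R]_n :=
  - outer zvec - outer zperp + (2 * k%:R)^-1 *: signmx (outer v).

End Instance.

(* Main.v *)
Require Import Defs.
From mathcomp Require Import all_boot all_order all_algebra.
From mathcomp Require Import all_classical all_reals.
From mathcomp Require Import ereal zify ring lra.

(* Write z' for zperp.  Since k zz^T + 2k z'z'^T is a subgradient of the l1 norm
   at zz^T, and already at 0, g X >= - <zz^T, X> / 2 for all X; this makes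
   (Z, s) = ((I - zz^T) / 2, -1/2) a dual certificate, with spectrum
   (1/2, ..., 1/2, 0).

   If v is that close to z, Cauchy-Schwarz forces its first k entries to be
   nonzero and of one sign, so sign (vv^T) = k zz^T and, with e = eta / 2, the
   projected point is Y = vv^T + e zz^T + 2e z'z'^T.  Its eigenvector z' has
   eigenvalue eta, and the top eigenvalue on span (v, z) is at most 1 + e, so
   the gap is below 1 and the simplex projection of the spectrum keeps both.
   The projection P is written down explicitly and certified by
   <Y - P, X - P> <= 0; its rank exceeds 1 because Tr (P^2) < (Tr P)^2. *)

Set Implicit Arguments.
Unset Strict Implicit.
Unset Printing Implicit Defensive.

Import Order.TTheory GRing.Theory Num.Theory.
Local Open Scope ring_scope.

(** * Frobenius inner product, rank-one matrices and positive semidefiniteness *)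

Section InnerProduct.
Variable R : realType.

Lemma innerE (m n : nat) (A B : 'M[R]_(m, n)) :
  inner A B = \sum_i \sum_j A i j * B i j.
Proof.
rewrite /inner /mxtrace exchange_big; apply: eq_bigr => j _.
by rewrite mxE; apply: eq_bigr => i _; rewrite mxE.
Qed.

Lemma innerC (m n : nat) (A B : 'M[R]_(m, n)) : inner A B = inner B A.
Proof. by rewrite /inner -mxtrace_tr trmx_mul trmxK. Qed.

Lemma innerDr (m n : nat) (A B C : 'M[R]_(m, n)) :
  inner A (B + C) = inner A B + inner A C.
Proof. by rewrite /inner mulmxDr mxtraceD. Qed.

Lemma innerZr (m n : nat) (a : R) (A B : 'M[R]_(m, n)) :
  inner A (a *: B) = a * inner A B.
Proof. by rewrite /inner -scalemxAr mxtraceZ. Qed.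

Lemma innerNr (m n : nat) (A B : 'M[R]_(m, n)) : inner A (- B) = - inner A B.
Proof. by rewrite -scaleN1r innerZr mulN1r. Qed.

Lemma innerDl (m n : nat) (A B C : 'M[R]_(m, n)) :
  inner (A + B) C = inner A C + inner B C.
Proof. by rewrite innerC innerDr !(innerC C). Qed.

Lemma innerZl (m n : nat) (a : R) (A B : 'M[R]_(m, n)) :
  inner (a *: A) B = a * inner A B.
Proof. by rewrite innerC innerZr innerC. Qed.

Lemma innerNl (m n : nat) (A B : 'M[R]_(m, n)) : inner (- A) B = - inner A B.
Proof. by rewrite innerC innerNr innerC. Qed.

Lemma inner0r (m n : nat) (A : 'M[R]_(m, n)) : inner A 0 = 0.
Proof. by rewrite -(scale0r 0) innerZr mul0r. Qed.

Definition inner_lin :=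
  (innerDl, innerDr, innerNl, innerNr, @innerZl, @innerZr).

Lemma inner_ge0 (m n : nat) (A : 'M[R]_(m, n)) : 0 <= inner A A.
Proof.
by rewrite innerE; do 2![apply: sumr_ge0 => ? _]; rewrite -expr2 sqr_ge0.
Qed.

Lemma inner_eq0 (m n : nat) (A : 'M[R]_(m, n)) : inner A A = 0 -> A = 0.
Proof.
rewrite innerE => /eqP; rewrite psumr_eq0; last first.
  by move=> i _; apply: sumr_ge0 => j _; rewrite -expr2 sqr_ge0.
move=> /allP h; apply/matrixP => i j; rewrite mxE.
have := h i (mem_index_enum i); rewrite psumr_eq0; last first.
  by move=> {}j _; rewrite -expr2 sqr_ge0.
move=> /allP /(_ j (mem_index_enum j)).
by rewrite /= -expr2 sqrf_eq0 => /eqP.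
Qed.

Lemma sqr_l2norm (m n : nat) (A : 'M[R]_(m, n)) : l2norm A ^+ 2 = inner A A.
Proof. by rewrite sqr_sqrtr // inner_ge0. Qed.

(** Cauchy-Schwarz, from expanding the squared norm of <B,B> A - <A,B> B, which is <B,B> times the
    difference of the two sides. *)
Lemma inner_sqr_le (m n : nat) (A B : 'M[R]_(m, n)) :
  inner A B ^+ 2 <= inner A A * inner B B.
Proof.
have [B0|B0] := eqVneq (inner B B) 0.
  by rewrite (inner_eq0 B0) inner0r inner0r expr0n mulr0.
have Bgt0 : 0 < inner B B by rewrite lt_neqAle eq_sym B0 inner_ge0.
have := inner_ge0 (inner B B *: A - inner A B *: B).
rewrite !inner_lin (innerC B A) => h.
rewrite -subr_ge0 -(pmulr_rge0 _ Bgt0); apply: le_trans h _.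
by rewrite le_eqVlt; apply/orP; left; apply/eqP; ring.
Qed.

Lemma inner_scalar1 (n : nat) (A : 'M[R]_n) : inner 1%:M A = \tr A.
Proof. by rewrite /inner trmx1 mul1mx. Qed.

Lemma mul_tr_col (n : nat) (a b : 'cV[R]_n) : a^T *m b = (inner a b)%:M.
Proof. by rewrite [LHS]mx11_scalar /inner /mxtrace big_ord1. Qed.

Lemma mul_outer_col (n : nat) (a b : 'cV[R]_n) :
  outer a *m b = inner a b *: a.
Proof. by rewrite /outer -mulmxA mul_tr_col mul_mx_scalar. Qed.

Lemma tr_outer (n : nat) (a : 'cV[R]_n) : (outer a)^T = outer a.
Proof. by rewrite /outer trmx_mul trmxK. Qed.

Lemma mxtrace_outer (n : nat) (a : 'cV[R]_n) : \tr (outer a) = inner a a.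
Proof. by rewrite /outer mxtrace_mulC. Qed.

Lemma inner_outerl (n : nat) (a : 'cV[R]_n) (A : 'M[R]_n) :
  inner (outer a) A = inner a (A *m a).
Proof. by rewrite /inner tr_outer /outer -mulmxA mxtrace_mulC mulmxA. Qed.

Lemma inner_outer (n : nat) (a b : 'cV[R]_n) :
  inner (outer a) (outer b) = inner a b ^+ 2.
Proof. by rewrite inner_outerl mul_outer_col innerZr innerC expr2. Qed.

Lemma outerE (n : nat) (a : 'cV[R]_n) i j : outer a i j = a i 0 * a j 0.
Proof. by rewrite /outer !mxE big_ord1 !mxE. Qed.

Lemma mulmx_outer_orth (n : nat) (a b : 'cV[R]_n) :
  inner a b = 0 -> outer a *m outer b = 0.
Proof. by move=> ab; rewrite /outer mulmxA mul_outer_col ab scale0r mul0mx. Qed.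

Lemma mulmx_outer_self (n : nat) (a : 'cV[R]_n) :
  outer a *m outer a = inner a a *: outer a.
Proof. by rewrite {2}/outer mulmxA mul_outer_col -scalemxAl. Qed.

Lemma rank_outer (n : nat) (a : 'cV[R]_n) :
  inner a a = 1 -> \rank (outer a) = 1%N.
Proof.
move=> a1; apply/eqP; rewrite eqn_leq; apply/andP; split.
  exact: leq_trans (mxrankM_maxl _ _) (rank_leq_col _).
rewrite lt0n mxrank_eq0; apply/eqP => a0.
by move: a1; rewrite -mxtrace_outer a0 mxtrace0 => /esym/eqP; rewrite oner_eq0.
Qed.

Lemma sym_mxP (n : nat) (A : 'M[R]_n) : reflect (A^T = A) (A \is symmetricmx).
Proof.
rewrite qualifE /= expr0 scale1r map_mx_id //.
by apply: (iffP eqP) => [{2}->|->].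
Qed.

Lemma inner_mulmx_sym (n : nat) (A : 'M[R]_n) (x y : 'cV[R]_n) :
  A^T = A -> inner x (A *m y) = inner (A *m x) y.
Proof. by move=> sA; rewrite /inner trmx_mul sA mulmxA. Qed.

Lemma psd_proj (n : nat) (A : 'M[R]_n) :
  A^T = A -> A *m A = A -> psd A.
Proof.
move=> sA AA; split; first exact/sym_mxP.
by move=> x; rewrite -AA -mulmxA inner_mulmx_sym // inner_ge0.
Qed.

Lemma psd_outer (n : nat) (a : 'cV[R]_n) : psd (outer a).
Proof.
split; first exact/sym_mxP/tr_outer.
by move=> x; rewrite mul_outer_col innerZr innerC -expr2 sqr_ge0.
Qed.

Lemma psdD (n : nat) (A B : 'M[R]_n) : psd A -> psd B -> psd (A + B).
Proof.
move=> [/sym_mxP sA A0] [/sym_mxP sB B0]; split.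
  by apply/sym_mxP; rewrite raddfD /= sA sB.
by move=> x; rewrite mulmxDl innerDr addr_ge0.
Qed.

Lemma psdZ (n : nat) (a : R) (A : 'M[R]_n) : 0 <= a -> psd A -> psd (a *: A).
Proof.
move=> a0 [/sym_mxP sA A0]; split.
  by apply/sym_mxP; rewrite linearZ /= sA.
by move=> x; rewrite -scalemxAl innerZr mulr_ge0.
Qed.

(** Here <Q, A> = Tr (Q A Q), and the diagonal entries of Q A Q are the quadratic form of A at the
    columns of Q. *)
Lemma inner_proj_psd_ge0 (n : nat) (Q A : 'M[R]_n) :
  Q^T = Q -> Q *m Q = Q -> psd A -> 0 <= inner Q A.
Proof.
move=> sQ QQ [_ A0].
rewrite /inner sQ -{1}QQ -mulmxA mxtrace_mulC /mxtrace.
apply: sumr_ge0 => i _.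
suff -> : (Q *m A *m Q) i i = inner (col i Q) (A *m col i Q) by [].
rewrite /inner tr_col sQ /mxtrace big_ord1 -mulmxA mxE [RHS]mxE.
apply: eq_bigr => j _; rewrite [row i Q _ _]mxE; congr (_ * _).
by rewrite !mxE; apply: eq_bigr => l _; rewrite [col i Q _ _]mxE.
Qed.

(** The previous bound for the complementary projection I - Q. *)
Lemma inner_proj_psd_le (n : nat) (Q A : 'M[R]_n) :
  Q^T = Q -> Q *m Q = Q -> psd A -> inner Q A <= \tr A.
Proof.
move=> sQ QQ A0; rewrite -subr_ge0 -inner_scalar1 -innerNl -innerDl.
apply: inner_proj_psd_ge0 => //; first by rewrite raddfB /= trmx1 sQ.
by rewrite mulmxBr mulmx1 mulmxBl mul1mx QQ subrr subr0.
Qed.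

(** A rank-one A factors as a column C times a row r, so Tr A is the scalar r C and Tr (A^2) is its
    square. Used contrapositively to bound a rank from below. *)
Lemma mxtrace_sqr_rank_le1 (n : nat) (A : 'M[R]_n) :
  (\rank A <= 1)%N -> \tr (A *m A) = \tr A ^+ 2.
Proof.
rewrite leq_eqVlt ltnS leqn0 mxrank_eq0 => /orP[/eqP rA|/eqP->]; last first.
  by rewrite mul0mx mxtrace0 expr0n.
have := mulmx_base A; move: (col_base A) (row_base A); rewrite rA => C r <-.
rewrite mulmxA mxtrace_mulC !mulmxA [\tr (C *m r)]mxtrace_mulC.
by rewrite -mulmxA /mxtrace !big_ord1 mxE big_ord1 expr2.
Qed.

End InnerProduct.

(* Two block-triangular factorizations of [[a I, u], [v, 1]]. *)
Lemma det_scalar_sub_rank1 (K : idomainType) (n : nat) (a : K)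
    (u : 'cV[K]_n.+1) (v : 'rV[K]_n.+1) :
  a != 0 -> \det (a%:M - u *m v) = a ^+ n * (a - (v *m u) 0 0).
Proof.
move=> a0; pose L := block_mx (a%:M : 'M_n.+1) u v (1%:M : 'M_1).
have -> : \det (a%:M - u *m v) = \det L.
  have /(congr1 determinant) :
      L *m block_mx 1%:M 0 (- v) 1%:M = block_mx (a%:M - u *m v) u 0 1%:M.
    by rewrite mulmx_block !mulmx1 !mulmx0 mulmxN !mul1mx subrr !add0r.
  by rewrite det_mulmx det_lblock det_ublock !det1 !mulr1.
apply: (mulIf a0).
have /(congr1 determinant) :
    L *m block_mx 1%:M (- u) 0 a%:M = block_mx a%:M 0 v (a%:M - v *m u).
  rewrite mulmx_block !mulmx1 !mulmx0 !mulmxN !mul1mx !addr0.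
  by rewrite mul_mx_scalar mul_scalar_mx addNr addrC.
rewrite det_mulmx det_lblock det_ublock det1 mul1r !det_scalar expr1 => ->.
by rewrite det_mx11 !mxE eqxx mulr1n exprSr; ring.
Qed.

(** * Spectra of rank-one perturbations, and a criterion for the projection *)

Section Spectrum.
Variable R : realType.

(** [det_scalar_sub_rank1] over the polynomial ring, with scalar X - a. *)
Lemma char_poly_scalar_add_outer (n : nat) (a b : R) (u : 'cV[R]_n.+1) :
  char_poly (a%:M + b *: outer u) =
  ('X - a%:P) ^+ n * ('X - (a + b * inner u u)%:P).
Proof.
rewrite /char_poly /char_poly_mx raddfD /= map_scalar_mx map_mxZ /outer.
rewrite map_mxM opprD addrA -raddfB /= scalemxAl.
rewrite det_scalar_sub_rank1 ?polyXsubC_eq0 //; congr (_ * _).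
rewrite -scalemxAr -map_mxM mul_tr_col !mxE eqxx mulr1n.
by rewrite polyCD polyCM opprD addrA.
Qed.

(** The characteristic polynomial fixes its roots up to permutation and sortedness fixes their
    order, so [xget] can only return s. *)
Lemma eigval_spectrum (n : nat) (A : 'M[R]_n) (s : seq R) (i : nat) :
  spectrum_of A s -> eigval i A = nth 0 s i.-1.
Proof.
move=> sA; rewrite /eigval (xget_unique _ sA) // => t [tA t_sorted].
case: sA => sA s_sorted.
apply: (sorted_eq ge_trans ge_anti) => //.
by apply/prod_XsubC_eq; rewrite -tA -sA.
Qed.

(** The spectrum is n - 1 copies of a followed by 0. Counting from 1, index n - 1 is the last copy
    of a. *)
Lemma eigval_outer_compl (n : nat) (a : R) (u : 'cV[R]_n) :
  (1 < n)%N -> 0 <= a -> inner u u = 1 ->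
  eigval n.-1 (a *: (1%:M - outer u)) = a.
Proof.
case: n u => [|[|n]] // u _ a0 u1.
rewrite (@eigval_spectrum _ _ (rcons (nseq n.+1 a) 0)).
  by rewrite nth_rcons size_nseq ltnSn nth_nseq ltnSn.
split.
  rewrite scalerBr -scaleNr scalemx1 char_poly_scalar_add_outer u1 mulr1 subrr.
  by rewrite -cats1 big_cat big_seq1 big_nseq iter_mulr mulr1.
by elim: n {u u1} => [|n IHn] /=; rewrite ?a0 // lexx.
Qed.

(** The obtuse-angle condition gives |Y - P|^2 + |X - P|^2 <= |Y - X|^2 on S, hence both minimality
    of P and uniqueness of the minimizer. *)
Lemma frob_proj_unique (n : nat) (S : set 'M[R]_n) (Y P : 'M[R]_n) :
  S P -> (forall X, S X -> inner (Y - P) (X - P) <= 0) -> frob_proj S Y = P.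
Proof.
move=> SP obtuse.
have dist X : S X ->
    l2norm (Y - P) ^+ 2 + l2norm (X - P) ^+ 2 <= l2norm (Y - X) ^+ 2.
  move=> /obtuse; rewrite !sqr_l2norm.
  have -> : Y - X = (Y - P) - (X - P) by rewrite opprB addrA subrK.
  move: (Y - P) (X - P) => A B; rewrite !inner_lin (innerC B A); lra.
have l2_ge0 (A : 'M[R]_n) : 0 <= l2norm A by apply: sqrtr_ge0.
apply: xget_unique => [|X [SX minX]]; first split => // X SX.
  rewrite -(@ler_pXn2r _ 2) ?nnegrE //.
  by apply: le_trans (dist X SX); rewrite lerDl sqr_ge0.
apply/eqP; rewrite -subr_eq0; apply/eqP/inner_eq0/eqP.
rewrite eq_le inner_ge0 andbT -sqr_l2norm.
have := dist X SX; have : l2norm (Y - X) ^+ 2 <= l2norm (Y - P) ^+ 2.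
  by rewrite ler_pXn2r ?nnegrE // minX.
lra.
Qed.

End Spectrum.

(** * Projection of the perturbed rank-one matrix onto the spectraplex *)

Section RankTwo.
Variable R : realType.

(** The normalized outer products sum to an orthogonal projection. A zero vector is allowed: it
    contributes 0, since the inverse of 0 is 0. *)
Lemma bessel_psd (n : nat) (a b x : 'cV[R]_n) (A : 'M[R]_n) :
  inner a b = 0 -> inner a x = 0 -> inner b x = 0 -> psd A ->
  (inner a a)^-1 * inner (outer a) A + (inner b b)^-1 * inner (outer b) A
    + (inner x x)^-1 * inner (outer x) A <= \tr A.
Proof.
move=> ab ax bx A0.
have [ba xa xb] : [/\ inner b a = 0, inner x a = 0 & inner x b = 0].
  by rewrite !(innerC _ a) (innerC x).
rewrite -!innerZl -!innerDl.
have idem (y : 'cV[R]_n) :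
    (inner y y)^-1 *: ((inner y y)^-1 *: (outer y *m outer y)) =
    (inner y y)^-1 *: outer y.
  rewrite mulmx_outer_self !scalerA; congr (_ *: _).
  have [->|y0] := eqVneq (inner y y) 0; first by rewrite invr0 !mul0r.
  by rewrite mulfVK.
apply: inner_proj_psd_le => //; first by rewrite !raddfD /= !linearZ /= !tr_outer.
rewrite !(mulmxDl, mulmxDr) -!scalemxAl -!scalemxAr.
rewrite !idem !mulmx_outer_orth //.
by rewrite !scaler0 !addr0 !add0r.
Qed.

Lemma frob_proj_rank_gt1 (n : nat) (e : R) (v z w : 'cV[R]_n) :
  inner v v = 1 -> inner z z = 1 -> inner w w = 1 ->
  inner v w = 0 -> inner z w = 0 -> inner z v != 0 ->
  0 < e -> e < 3^-1 ->
  (1 < \rank (frob_proj (@spectraplex R n)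
                (outer v + e *: outer z + (2 * e) *: outer w)))%N.
Proof.
move=> vv zz ww vw zw; set c := inner z v => c0 e0 e1.
have c2 : 0 < c ^+ 2 by rewrite exprn_even_gt0.
have c2_le1 : c ^+ 2 <= 1.
  by have := inner_sqr_le z v; rewrite zz vv mulr1.
(* 1 + t is the top eigenvalue of vv^T + e zz^T, with eigenvector c v + t z. *)
have [t t0 ht] : exists2 t, 0 <= t & t * (1 + t - e) = c ^+ 2 * e.
  (* t is the nonnegative root of t^2 + (1 - e) t - c^2 e, and d^2 is its discriminant. *)
  pose d := Num.sqrt ((1 - e) ^+ 2 + 4 * (c ^+ 2 * e)).
  have ce0 : 0 < c ^+ 2 * e by rewrite mulr_gt0.
  have d2 : d ^+ 2 = (1 - e) ^+ 2 + 4 * (c ^+ 2 * e).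
    by rewrite sqr_sqrtr // addr_ge0 ?sqr_ge0 // mulr_ge0 // ltW.
  have d0 : 0 <= d := sqrtr_ge0 _.
  exists ((d - (1 - e)) / 2); last first.
    by transitivity ((d ^+ 2 - (1 - e) ^+ 2) / 4); [field|rewrite d2; field].
  suff : 1 - e <= d by lra.
  by rewrite -(@ler_pXn2r _ 2) ?nnegrE // ?d2; lra.
(* If t > e, then 1 + t - e > 1 and the left side of [ht] exceeds e >= c^2 e. *)
have te : t <= e by nra.
pose h := 1 + t - e; have h0 : 0 < h by rewrite /h; lra.
rewrite -/h in ht.
pose D := c ^+ 2 * (1 + 2 * t) + t ^+ 2.
have D0 : 0 < D by rewrite /D; nra.
(* D is the squared norm of the top eigenvector u. [kap] is the value that cancels the mixed terms
   in [coef3]; it is the second eigenvalue e - t divided by <x, x>, in a form that still makes sense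
   when x = 0, as happens for v = z or v = -z. *)
pose kap := (1 + t) * t / (D * h).
have kap0 : 0 <= kap.
  by rewrite divr_ge0 ?mulr_ge0 ?(ltW D0) ?(ltW h0) ?addr_ge0.
pose u := c *: v + t *: z; pose x := c *: v - h *: z.
have uu : inner u u = D.
  by rewrite /u !inner_lin vv zz (innerC v z) -/c /D; ring.
have ux : inner u x = 0.
  rewrite /u /x !inner_lin vv zz (innerC v z) -/c.
  rewrite [LHS](_ : _ = c ^+ 2 * e - t * h); last by rewrite /h; ring.
  by rewrite ht subrr.
have uw : inner u w = 0 by rewrite !inner_lin vw zw !mulr0 addr0.
have xw : inner x w = 0 by rewrite !inner_lin vw zw !mulr0 subr0.
(* The two sides differ by a multiple of t h - c^2 e, which [ht] makes zero. *)
have Dh : D * h = (1 + t) * (h + t) * c ^+ 2.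
  apply/eqP; rewrite -subr_eq0; apply/eqP.
  transitivity (t * (t * h - c ^+ 2 * e)); first by rewrite /D /h; ring.
  by rewrite ht subrr mulr0.
have [wu xu wx] : [/\ inner w u = 0, inner x u = 0 & inner w x = 0].
  by rewrite (innerC w u) (innerC x u) (innerC w x).
have coef1 : (1 + t) / D * c ^+ 2 + kap * c ^+ 2 = 1.
  transitivity ((1 + t) * (h + t) * c ^+ 2 / (D * h)).
    by rewrite /kap; field; rewrite !gt_eqF.
  by rewrite -Dh divff // mulf_neq0 ?gt_eqF.
have coef2 : (1 + t) / D * t ^+ 2 + kap * h ^+ 2 = e.
  transitivity ((1 + t) * (h + t) * (t * h) / (D * h)).
    by rewrite /kap; field; rewrite !gt_eqF.
  by rewrite ht mulrA -Dh mulrAC divff ?mul1r // mulf_neq0 ?gt_eqF.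
have coef3 : (1 + t) / D * (c * t) = kap * (c * h).
  by rewrite /kap; field; rewrite !gt_eqF.
have spec : outer v + e *: outer z = ((1 + t) / D) *: outer u + kap *: outer x.
  apply/matrixP => i j; rewrite !mxE !big_ord1 !mxE.
  set a := v i 0; set b := z i 0; set a' := v j 0; set b' := z j 0.
  transitivity (((1 + t) / D * c ^+ 2 + kap * c ^+ 2) * (a * a')
     + ((1 + t) / D * (c * t) - kap * (c * h)) * (a * b' + b * a')
     + ((1 + t) / D * t ^+ 2 + kap * h ^+ 2) * (b * b')); last by ring.
  by rewrite coef1 coef2 coef3; ring.
(* Compare traces in [spec]: 1 + e on the left, 1 + t from u on the right. *)
have xx : kap * inner x x = e - t.
  have := congr1 mxtrace spec.
  rewrite !mxtraceD !mxtraceZ !mxtrace_outer vv zz uu mulr1 divfK ?gt_eqF //.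
  lra.
(* The eigenvalues on u, w, x are 1 + t, 2e, e - t. The simplex projection subtracts [tau] from the
   first two, giving p and q, and cuts the third to 0; p + q = 1 determines [tau]. *)
pose p := (2 + t - 2 * e) / 2; pose q := (2 * e - t) / 2.
pose tau := (t + 2 * e) / 2.
pose P := (p / D) *: outer u + q *: outer w.
have p0 : 0 < p by rewrite /p; lra.
have q0 : 0 < q by rewrite /q; lra.
have pq : p + q = 1 by rewrite /p /q; field.
have trP : \tr P = 1.
  by rewrite mxtraceD !mxtraceZ !mxtrace_outer uu ww mulr1 divfK ?gt_eqF.
have sP : P^T = P by rewrite raddfD /= !linearZ /= !tr_outer.
have psdP : psd P.
  apply: psdD; apply: psdZ; [|exact: psd_outer|exact: ltW|exact: psd_outer].
  by rewrite divr_ge0 ?ltW.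
have YP : outer v + e *: outer z + (2 * e) *: outer w - P =
    (tau / D) *: outer u + tau *: outer w + kap *: outer x.
  rewrite spec /P; apply/matrixP => i j.
  rewrite !mxE /p /q /tau; field; exact: lt0r_neq0.
have -> : frob_proj (@spectraplex R n)
    (outer v + e *: outer z + (2 * e) *: outer w) = P.
  apply: frob_proj_unique => // X [psdX trX]; rewrite YP innerDr innerNr.
  have -> : inner (tau / D *: outer u + tau *: outer w + kap *: outer x) P = tau.
    rewrite /P !inner_lin !inner_outer uu ww uw wu xu xw.
    transitivity (tau * (p + q)); last by rewrite pq mulr1.
    by field; exact: lt0r_neq0.
  rewrite subr_le0.
  have := bessel_psd uw ux wx psdX.
  rewrite uu ww invr1 mul1r trX => bes.
  have tau0 : 0 <= tau by rewrite /tau; lra.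
  (* Since e - t <= [tau], the weight on x can be raised to [tau], after which [bessel_psd] bounds
     <Y - P, X> by [tau] = <Y - P, P>. *)
  have xX : kap * inner (outer x) X <=
      tau * ((inner x x)^-1 * inner (outer x) X).
    have [x0|x0] := eqVneq (inner x x) 0.
      by rewrite x0 (inner_eq0 x0) inner_outerl mulmx0 inner0r !mulr0.
    rewrite mulrA ler_wpM2r //.
      by rewrite inner_outerl; case: psdX => _; apply.
    rewrite ler_pdivlMr ?xx; last by rewrite lt_neqAle eq_sym x0 inner_ge0.
    by rewrite /tau; lra.
  rewrite !innerDl !innerZl -mulrA.
  have := ler_wpM2l tau0 bes; rewrite !mulrDr mulr1; lra.
rewrite ltnNge; apply/negP => /mxtrace_sqr_rank_le1.
rewrite trP -{1}sP -/(inner P P) /P !inner_lin !inner_outer uw uu ww wu.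
rewrite !expr0n /= !mulr0 addr0 add0r.
have -> : p / D * (p / D * D ^+ 2) + q * (q * 1 ^+ 2) =
    (p + q) ^+ 2 - 2 * (p * q) by field; exact: lt0r_neq0.
by rewrite pq => h2; have := mulr_gt0 p0 q0; lra.
Qed.

End RankTwo.

(** * The entrywise l1 norm and its dual bound; rank-one projections *)

Section L1Norm.
Variable R : realType.

Lemma inner_signmx (m n : nat) (A : 'M[R]_(m, n)) :
  inner (signmx A) A = l1norm A.
Proof.
rewrite innerE; apply: eq_bigr => i _; apply: eq_bigr => j _.
by rewrite mxE -normrEsg.
Qed.

Lemma inner_le_l1norm (m n : nat) (S A : 'M[R]_(m, n)) :
  (forall i j, `|S i j| <= 1) -> inner S A <= l1norm A.
Proof.
move=> S1; rewrite innerE; apply: ler_sum => i _; apply: ler_sum => j _.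
by apply: le_trans (ler_norm _) _; rewrite normrM ler_piMl.
Qed.

Lemma signmx_le1 (m n : nat) (A : 'M[R]_(m, n)) i j : `|signmx A i j| <= 1.
Proof. by rewrite mxE normr_sg lern1; case: eqP. Qed.

Lemma inner_delta_mx (n : nat) (x : 'cV[R]_n) (i : 'I_n) :
  inner x (delta_mx i 0) = x i 0.
Proof.
rewrite innerE; under eq_bigr do rewrite big_ord1 mxE.
rewrite (bigD1 i) //= !eqxx mulr1 big1 ?addr0 // => j ji.
by rewrite (negPf ji) mulr0.
Qed.

Lemma psd_outer_compl (n : nat) (a : 'cV[R]_n) :
  inner a a = 1 -> psd (1%:M - outer a).
Proof.
move=> a1; apply: psd_proj; first by rewrite raddfB /= trmx1 tr_outer.
by rewrite mulmxBr mulmx1 mulmxBl mul1mx mulmx_outer_self a1 scale1r subrr subr0.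
Qed.

Lemma inner_outer_psd_le (n : nat) (a : 'cV[R]_n) (A : 'M[R]_n) :
  inner a a = 1 -> psd A -> inner (outer a) A <= \tr A.
Proof.
move=> a1; apply: inner_proj_psd_le; first exact: tr_outer.
by rewrite mulmx_outer_self a1 scale1r.
Qed.

End L1Norm.

(** * The concrete vectors z and z', and the objective *)

Section Instance.
Variables (R : realType) (n k : nat).
Hypotheses (k_gt0 : (0 < k)%N) (k4n : (4 * k <= n)%N).

Let z : 'cV[R]_n := zvec R n k.
Let zp : 'cV[R]_n := zperp R n k.
Let g : 'M[R]_n -> R := gobj k.

Let kR : 0 < k%:R :> R. Proof. by rewrite ltr0n. Qed.
Let kn : (k <= n)%N. Proof. by apply: leq_trans k4n; rewrite leq_pmull. Qed.
Let nkR : 0 < (n - k)%:R :> R.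
Proof. by rewrite ltr0n subn_gt0; lia. Qed.

Lemma sqr_invsqrt (m : nat) : (Num.sqrt m%:R)^-1 ^+ 2 = m%:R^-1 :> R.
Proof. by rewrite exprVn sqr_sqrtr. Qed.

Lemma sum_lt_ord (F : nat -> R) :
  \sum_(i < n) (if (i < k)%N then F i else 0) = \sum_(i < k) F i.
Proof. by rewrite -big_mkcond -big_ord_widen. Qed.

Lemma inner_zvec : inner z z = 1.
Proof.
rewrite innerE -[RHS](@mulfV _ k%:R) ?gt_eqF //.
transitivity (\sum_(i < n) (if (i < k)%N then k%:R^-1 else 0 : R)).
  apply: eq_bigr => i _; rewrite big_ord1 !mxE; case: ifP => _.
    by rewrite -expr2 sqr_invsqrt.
  by rewrite mulr0.
by rewrite (sum_lt_ord (fun=> k%:R^-1)) sumr_const card_ord mulr_natl.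
Qed.

Lemma inner_zperp : inner zp zp = 1.
Proof.
rewrite innerE -[RHS](@mulfV _ (n - k)%:R) ?gt_eqF //.
(* The indicator of k <= i is written as 1 minus that of i < k, so that [sum_lt_ord] applies. *)
transitivity (\sum_(i < n) ((n - k)%:R^-1 -
    if (i < k)%N then (n - k)%:R^-1 else 0 : R)).
  apply: eq_bigr => i _; rewrite big_ord1 !mxE; case: ltnP => _.
    by rewrite mulr0 subrr.
  by rewrite -expr2 sqr_invsqrt subr0.
rewrite sumrB (sum_lt_ord (fun=> (n - k)%:R^-1)) !sumr_const !card_ord -mulrnBr //.
by rewrite mulr_natl.
Qed.

Lemma inner_zperp_supp (v : 'cV[R]_n) :
  vsupport v \subset vsupport z -> inner v zp = 0.
Proof.
move=> /fintype.subsetP vz; rewrite innerE big1 // => i _; rewrite big_ord1 mxE.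
case: ifP => ki; last by rewrite mulr0.
have [->|vi] := eqVneq (v i 0) 0; first by rewrite mul0r.
by have := vz i vi; rewrite inE mxE ltnNge ki eqxx.
Qed.

Lemma zvec_zperp : inner z zp = 0.
Proof. exact/inner_zperp_supp. Qed.

(** Remove entry i from z: the rest has squared norm 1 - 1/k and inner product c - z_i v_i with v.
    If c v_i <= 0, the square of the latter is at least c^2 >= 1 - 1/(2k^2) > 1 - 1/k, against
    Cauchy-Schwarz. *)
Lemma sign_correlated (v : 'cV[R]_n) (i : 'I_n) :
  inner v v = 1 -> 1 - (2 * k%:R ^+ 2)^-1 <= inner z v ^+ 2 -> (i < k)%N ->
  0 < inner z v * v i 0.
Proof.
move=> vv; set c := inner z v => hc ik.
have zi : z i 0 ^+ 2 = k%:R^-1 by rewrite mxE ik sqr_invsqrt.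
have zi0 : 0 < z i 0 by rewrite mxE ik invr_gt0 sqrtr_gt0.
have dd : (delta_mx i 0 : 'cV[R]_n) i 0 = 1 by rewrite mxE !eqxx.
have := inner_sqr_le (z - z i 0 *: delta_mx i 0) v.
rewrite !inner_lin vv inner_zvec !inner_delta_mx !(innerC (delta_mx i 0)).
rewrite !inner_delta_mx -/c dd => h.
rewrite ltNge; apply/negP => cv.
have k2 : (2 * k%:R ^+ 2)^-1 < k%:R^-1 :> R.
  rewrite ltf_pV2 ?posrE ?mulr_gt0 ?exprn_gt0 //.
  have : 1 <= k%:R :> R by rewrite ler1n.
  by nra.
have : c * (z i 0 * v i 0) <= 0 by rewrite mulrCA pmulr_rle0.
have := sqr_ge0 (z i 0 * v i 0).
move: h hc k2 zi; nra.
Qed.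

Lemma signmx_outer (v : 'cV[R]_n) :
  vsupport v \subset vsupport z -> inner v v = 1 ->
  1 - (2 * k%:R ^+ 2)^-1 <= inner z v ^+ 2 ->
  signmx (outer v) = k%:R *: outer z.
Proof.
move=> /fintype.subsetP vz vv hc; have pos i := @sign_correlated v i vv hc.
have v0 (i : 'I_n) : (k <= i)%N -> v i 0 = 0.
  move=> ki; apply/eqP; apply: contraT => /(vz i).
  by rewrite inE mxE ltnNge ki eqxx.
have z0 (i : 'I_n) : (k <= i)%N -> z i 0 = 0 by move=> ki; rewrite mxE ltnNge ki.
apply/matrixP => i j; rewrite [LHS]mxE [RHS]mxE !outerE.
have [ki|ik] := leqP k i; first by rewrite v0 // z0 // !mul0r sgr0 mulr0.
have [kj|jk] := leqP k j; first by rewrite (v0 j) // (z0 j) // !mulr0 sgr0.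
rewrite !mxE ik jk -expr2 sqr_invsqrt mulfV ?gt_eqF //.
apply/gtr0_sg.
(* The product of c v_i and c v_j is c^2 v_i v_j, so v_i v_j > 0. *)
have := mulr_gt0 (pos i ik) (pos j jk); rewrite mulrACA -expr2.
by rewrite pmulr_rgt0 // lt_neqAle sqr_ge0 eq_sym sqrf_eq0 andbT;
  apply: contraTneq (pos i ik) => ->; rewrite mul0r ltxx.
Qed.

(** The sign matrix pairs with vv^T to its l1 norm and, having entries of modulus at most 1, with
    any Y to at most the l1 norm of Y. *)
Lemma subdiff_gsubgrad (v : 'cV[R]_n) : subdiff g (outer v) (gsubgrad k v).
Proof.
split.
  apply/sym_mxP; rewrite /gsubgrad !raddfD /= !raddfN /= linearZ /= !tr_outer.
  congr (_ + _ *: _); apply/matrixP => i j; rewrite !mxE.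
  by congr Num.sg; apply: eq_bigr => l _; rewrite !mxE mulrC.
move=> Y _; rewrite /g /gobj /gsubgrad !inner_lin.
rewrite -(inner_signmx (outer v)).
have := inner_le_l1norm Y (signmx_le1 (outer v)).
rewrite -(@ler_pM2l _ (2 * k%:R)^-1) ?invr_gt0 ?mulr_gt0 //.
lra.
Qed.

(* The entries of 2k z'z'^T are 2k / (n - k) <= 2/3 because 4k <= n. *)
Lemma gobj_ge (X : 'M[R]_n) : - 2^-1 * inner (outer z) X <= g X.
Proof.
have S1 i j : `|(k%:R *: outer z + (2 * k%:R) *: outer zp) i j| <= 1.
  rewrite !mxE !big_ord1 !mxE.
  case: (ltnP i) => _; case: (ltnP j) => _; rewrite ?(mulr0, mul0r, addr0, add0r).
  - by rewrite -expr2 sqr_invsqrt mulfV ?gt_eqF // normr1.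
  - by rewrite normr0.
  - by rewrite normr0.
  rewrite -expr2 sqr_invsqrt ger0_norm ?ler_pdivrMr ?mul1r // -?natrM ?ler_nat.
  by lia.
have := inner_le_l1norm X S1.
rewrite -(@ler_pM2l _ (2 * k%:R)^-1) ?invr_gt0 ?mulr_gt0 // !inner_lin.
have -> (a b : R) : (2 * k%:R)^-1 * (k%:R * a + 2 * k%:R * b) = 2^-1 * a + b.
  by field; rewrite gt_eqF.
rewrite /g /gobj !inner_lin; lra.
Qed.

(** * Primal optimality of zz^T *)

Lemma zvec_correlated : 1 - (2 * k%:R ^+ 2)^-1 <= inner z z ^+ 2.
Proof.
by rewrite inner_zvec expr1n gerBl invr_ge0 mulr_ge0 ?exprn_ge0 // ltW.
Qed.

Lemma gobj_outer_z : g (outer z) = - 2^-1.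
Proof.
rewrite /g /gobj -inner_signmx.
rewrite signmx_outer ?zvec_correlated ?inner_zvec ?fintype.subxx //.
rewrite !inner_lin !inner_outer inner_zvec (innerC _ z) zvec_zperp expr1n expr0n /=.
by field; rewrite gt_eqF.
Qed.

Lemma primal_optimal_z : primal_optimal g (outer z).
Proof.
split.
  by split; [exact: psd_outer|rewrite mxtrace_outer inner_zvec].
move=> X [psdX trX]; rewrite gobj_outer_z; apply: le_trans (gobj_ge X).
have := inner_outer_psd_le inner_zvec psdX; rewrite trX; lra.
Qed.

(** * The dual certificate and strict complementarity *)

Let Z : 'M[R]_n := 2^-1 *: (1%:M - outer z).

(** The Lagrangian is g X + <zz^T, X> / 2 - 1/2, at least -1/2 by [gobj_ge] and equal to -1/2 at X =
    0. *)
Lemma dual_value_Z : dual_value g Z (- 2^-1) = (- 2^-1)%:E.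
Proof.
apply/eqP; rewrite eq_le; apply/andP; split.
  apply: ge_ereal_inf; exists (- 2^-1)%:E => //; exists 0.
    by apply/sym_mxP; rewrite trmx0.
  rewrite /g /gobj /l1norm !inner0r mxtrace0 big1 => [|i _]; last first.
    by rewrite big1 // => j _; rewrite mxE normr0.
  by congr _%:E; ring.
apply: le_ereal_inf_tmp => _ [X _ <-]; rewrite lee_fin.
have := gobj_ge X; rewrite /Z !inner_lin inner_scalar1; lra.
Qed.

Lemma psd_Z : psd Z.
Proof. by apply: psdZ; [rewrite invr_ge0|exact/psd_outer_compl/inner_zvec]. Qed.

(** Weak duality: at zz^T, of trace 1, any feasible Lagrangian equals -1/2 - <Z', zz^T> <= -1/2. *)
Lemma dual_optimal_Z : dual_optimal g Z (- 2^-1).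
Proof.
split; first by split; [exact: psd_Z|rewrite dual_value_Z].
move=> Z' s' [[_ Z'0] _]; rewrite dual_value_Z.
apply: ge_ereal_inf; eexists; first exists (outer z) => //.
  exact/sym_mxP/tr_outer.
rewrite lee_fin gobj_outer_z mxtrace_outer inner_zvec.
have := Z'0 z; rewrite -inner_outerl innerC; lra.
Qed.

(** Z z = 0 bounds the rank above; I = (I - zz^T) + zz^T and subadditivity of rank bound it
    below. *)
Lemma rank_Z : \rank Z = n.-1.
Proof.
have Zz : Z *m z = 0.
  rewrite /Z -scalemxAl mulmxBl mul1mx mul_outer_col inner_zvec scale1r subrr.
  by rewrite scaler0.
have rz := rank_outer inner_zvec.
apply/eqP; rewrite eqn_leq; apply/andP; split.
  have := mulmx0_rank_max Zz.
  have := mxrankM_maxl z z^T; rewrite -/(outer z) rz; lia.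
have : (\rank (1%:M : 'M[R]_n) <= \rank Z + \rank (outer z))%N.
  rewrite -[1%:M](subrK (outer z)).
  apply: leq_trans (mxrank_add _ _) _; rewrite leq_add2r.
  by rewrite -(@mxrank_scale_nz _ _ _ 2^-1) // invr_eq0.
rewrite mxrank1 rz; lia.
Qed.

Lemma strict_complementarity_z : strict_complementarity g (outer z) 2^-1.
Proof.
split; [exact: primal_optimal_z|by rewrite invr_gt0|].
exists Z, (- 2^-1); rewrite (rank_outer inner_zvec) subn1; split.
- exact: dual_optimal_Z.
- exact: rank_Z.
- by rewrite eigval_outer_compl ?inner_zvec ?invr_ge0 //; lia.
Qed.

(** * Rank of the projected subgradient step *)

Lemma rank_proj_gt1 (eta : R) (v : 'cV[R]_n) :
  0 < eta -> eta < 2 / 3 ->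
  inner v v = 1 -> vsupport v \subset vsupport z ->
  1 - (2 * k%:R ^+ 2)^-1 <= inner z v ^+ 2 ->
  (1 < \rank (frob_proj (@spectraplex R n) (outer v - eta *: gsubgrad k v)))%N.
Proof.
move=> eta0 eta1 vv vz hc.
have -> : outer v - eta *: gsubgrad k v =
    outer v + (eta / 2) *: outer z + (2 * (eta / 2)) *: outer zp.
  rewrite /gsubgrad signmx_outer // -/z -/zp.
  apply/matrixP => i j; rewrite !mxE; field; exact: lt0r_neq0.
apply: frob_proj_rank_gt1 => //; rewrite ?inner_zvec ?inner_zperp //.
- exact: inner_zperp_supp.
- exact: zvec_zperp.
(* A zero overlap <z, v> would contradict [hc], because 1/(2k^2) < 1. *)
- apply: contraTneq hc => ->; rewrite expr0n /= -ltNge subr_gt0.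
  rewrite invf_lt1 ?mulr_gt0 ?exprn_gt0 //.
  have : 1 <= k%:R :> R by rewrite ler1n.
  by nra.
- by rewrite divr_gt0.
- lra.
Qed.

End Instance.

Theorem lemma4 (R : realType) (n k : nat)
    (hn : (1 <= n)%N) (hk : (1 <= k)%N) (hkn : k%:R <= n%:R / 4 :> R) :
  let z : 'cV[R]_n := zvec R n k in
  let g : 'M[R]_n -> R := gobj k in
  [/\ primal_optimal g (outer z),
      \rank (outer z) = 1%N &
      exists delta : R, strict_complementarity g (outer z) delta]
  /\
  (forall (eta : R) (v : 'cV[R]_n),
     0 < eta -> eta < 2 / 3 ->
     l2norm v = 1 ->
     vsupport v \subset vsupport z ->
     1 - (2 * k%:R ^+ 2)^-1 <= inner z v ^+ 2 ->
     [/\ inner z v ^+ 2 = 1 - 2^-1 * l2norm (outer v - outer z) ^+ 2,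
         subdiff g (outer v) (gsubgrad k v) &
         (1 < \rank (frob_proj (@spectraplex R n) (outer v - eta *: gsubgrad k v)))%N]).
Proof.
move=> z g.
have k4n : (4 * k <= n)%N.
  by move: hkn; rewrite ler_pdivlMr // -natrM ler_nat mulnC.
split.
  split; first exact: primal_optimal_z.
    exact/rank_outer/inner_zvec.
  by exists 2^-1; apply: strict_complementarity_z.
move=> eta v eta0 eta1 v1 vz hc.
have vv : inner v v = 1 by rewrite -sqr_l2norm v1 expr1n.
split.
- rewrite sqr_l2norm !inner_lin !inner_outer vv inner_zvec // (innerC v z).
  by rewrite expr1n; field.
- exact: subdiff_gsubgrad.
- exact: rank_proj_gt1.
Qed.
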